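(* Let $\rho\in(-1,1)$ with $|\rho|\in(0,1)$, and let $a>0$ with $a\neq 1$. Suppose $\mu_1=\mu_2=0$, $a_{12}=1$ and $a_{11}=a_{22}=a$ (both variances change equally). Then the sensitivities $H_1$ and $H_2$ of the two projections (as defined in the context) satisfy $H_2=H_1$.
   Context: Bivariate change setting. The pre-change mean is $\boldsymbol{\mu}_0=\mathbf 0\in\mathbb{R}^2$ and the post-change mean is $\boldsymbol{\mu}_1=(\mu_1,\mu_2)^\top$. The pre- and post-change covariance matrices are $$\boldsymbol{\Sigma}_0=\begin{pmatrix}1&\rho\\ \rho&1\end{pmatrix},\qquad \boldsymbol{\Sigma}_1=\begin{pmatrix}a_{11}^2& a_{11}a_{22}a_{12}\rho\\ a_{11}a_{22}a_{12}\rho& a_{22}^2\end{pmatrix},$$ where $-1<\rho<1$, $\rho\neq 0$, $-1<a_{12}\rho<1$; $a_{11},a_{22}>0$ are multiplicative change factors of the standard deviations and $a_{12}$ is the multiplicative change factor of the correlation. Let $(\lambda_j,\mathbf v_j)_{j=1,2}$ be the eigenvalues and normalized (unit) eigenvectors of $\boldsymbol{\Sigma}_0$, ordered so that $\lambda_1\ge\lambda_2$ (since $\rho\ne0$ the eigenvalues are distinct, so $\mathbf v_j$ is unique up to sign, which does not affect the quantities below). For $j=1,2$ let $p_j$ be the density of the normal distribution with mean $\mathbf v_j^\top\boldsymbol{\mu}_0=0$ and variance $\mathbf v_j^\top\boldsymbol{\Sigma}_0\mathbf v_j=\lambda_j$, and let $q_j$ be the density of the normal distribution with mean $\mathbf v_j^\top\boldsymbol{\mu}_1$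 and variance $\mathbf v_j^\top\boldsymbol{\Sigma}_1\mathbf v_j$. The sensitivity of the $j$-th projection is $H_j=H(p_j,q_j)\ge 0$, where $H$ is the Hellinger distance; for normal densities $p,q$ with means $\xi_1,\xi_2$ and standard deviations $\sigma_1,\sigma_2>0$, $$H^2(p,q)=1-\sqrt{\frac{2\sigma_1\sigma_2}{\sigma_1^2+\sigma_2^2}}\,\exp\left\{-\frac14\,\frac{(\xi_1-\xi_2)^2}{\sigma_1^2+\sigma_2^2}\right\}.$$ *)

(* Defs.v *)
From HB Require Import structures.
From mathcomp Require Import all_boot all_order all_algebra.
From mathcomp Require Import all_classical all_reals all_analysis.

Set Implicit Arguments.
Unset Strict Implicit.
Unset Printing Implicit Defensive.

Import Order.TTheory GRing.Theory Num.Theory.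
Import numFieldNormedType.Exports.

Local Open Scope ring_scope.

Definition pre_mean (R : realType) : 'cV[R]_2 := 0.

Definition post_mean (R : realType) (mu1 mu2 : R) : 'cV[R]_2 :=
  \col_i nth 0 [:: mu1; mu2] i.

Definition pre_cov (R : realType) (rho : R) : 'M[R]_2 :=
  \matrix_(i, j) nth 0 (nth [::] [:: [:: 1;   rho];
                                     [:: rho; 1  ]] i) j.

Definition post_cov (R : realType) (a11 a22 a12 rho : R) : 'M[R]_2 :=
  \matrix_(i, j)
    nth 0 (nth [::] [:: [:: a11 ^+ 2;               a11 * a22 * a12 * rho];
                        [:: a11 * a22 * a12 * rho;  a22 ^+ 2             ]] i) j.

(* The eigenvalues are listed with multiplicity and indexed from 0, largest
   first.  Orthogonality of the [v i] is not imposed: it is automatic for a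
   symmetric matrix with distinct eigenvalues. *)
Definition ordered_eigenpairs (R : realType) (n : nat) (S : 'M[R]_n)
    (lam : 'I_n -> R) (v : 'I_n -> 'cV[R]_n) : Prop :=
  [/\ char_poly S = \prod_(i < n) ('X - (lam i)%:P),
      forall i j : 'I_n, (i <= j)%N -> lam j <= lam i,
      forall i : 'I_n, S *m v i = lam i *: v i
    & forall i : 'I_n, (v i)^T *m v i = 1%:M].

Definition proj_mean (R : realType) (n : nat) (v mu : 'cV[R]_n) : R :=
  (v^T *m mu) ord0 ord0.

Definition proj_var (R : realType) (n : nat) (v : 'cV[R]_n) (S : 'M[R]_n) : R :=
  (v^T *m S *m v) ord0 ord0.

(* [normal_pdf] takes the standard deviation; here [s2] is the variance. *)
Definition normal_density (R : realType) (m s2 : R) : R -> R :=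
  normal_pdf m (Num.sqrt s2).

(* The factor 1/2 normalizes the distance to [0, 1], so that its square is
   1 - \int sqrt (p * q) for probability densities p and q. *)
Definition hellinger (R : realType) (p q : R -> R) : R :=
  Num.sqrt (2^-1 * \int[@lebesgue_measure R]_x
                     (Num.sqrt (p x) - Num.sqrt (q x)) ^+ 2).

Definition sensitivity (R : realType) (n : nat) (mu0 mu1 : 'cV[R]_n)
    (S0 S1 : 'M[R]_n) (v : 'cV[R]_n) : R :=
  hellinger (normal_density (proj_mean v mu0) (proj_var v S0))
            (normal_density (proj_mean v mu1) (proj_var v S1)).

(* Main.v *)
(* Since Sigma_1 = a^2 Sigma_0, the two projected laws are N(0, s^2) and
   N(0, (a s)^2) for a projection with pre-change standard deviation s > 0.
   The Hellinger distance is invariant under a common rescaling of both laws,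
   so it depends on a only, not on s. *)
Require Import Defs.
From HB Require Import structures.
From mathcomp Require Import all_boot all_order all_algebra.
From mathcomp Require Import all_classical all_reals all_analysis.
From mathcomp Require Import ring lra.
Import Order.TTheory GRing.Theory Num.Theory.
Import numFieldNormedType.Exports.
Local Open Scope ring_scope.

(** Change of variables along the increasing bijection [x |-> c * x] of the line, whose derivative
    is the constant [c]. *)
Lemma ge0_integral_scale (R : realType) (c : R) (G : R -> R) :
  0 < c -> continuous G -> (forall x, 0 <= G x) ->
  (\int[@lebesgue_measure R]_x (G x)%:E =
   \int[@lebesgue_measure R]_x (G (c * x) * c)%:E)%E.
Proof.
move=> c0 cG G0.
have dF (x : R) : is_derive x (1 : R) ( *%R c) c.
  by apply: (is_derive_eq (is_deriveZ c _)); rewrite /GRing.scale/= mulr1.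
have F'E : derive1 ( *%R c : R -> R) = cst c.
  by apply/funext => x; rewrite derive1E derive_val.
rewrite (@increasing_ge0_integration_by_substitutionT R ( *%R c)) //.
- by rewrite F'E.
- by move=> x y xy; rewrite ltr_pM2l.
- by rewrite F'E; apply: cst_continuous.
- by rewrite F'E; apply: is_cvg_cst.
- by rewrite F'E; apply: is_cvg_cst.
- by apply: gt0_cvgMrNy => //; exact: cvg_id.
- by apply: gt0_cvgMry => //; exact: cvg_id.
Qed.

(** In the exponent [c ^+ 2] cancels between the squared deviation and the variance, so only the
    peak contributes the factor [c^-1]. *)
Lemma normal_pdf_scale (R : realType) (c m s x : R) : 0 < c -> s != 0 ->
  normal_pdf (c * m) (c * s) (c * x) = c^-1 * normal_pdf m s x.
Proof.
move=> c0 s0; have cn0 : c != 0 by rewrite gt_eqF.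
rewrite !normal_pdfE ?mulf_neq0// mulrA; congr (_ * _).
  rewrite /normal_peak exprMn -mulrA -mulrnAr sqrtrM ?sqr_ge0// sqrtr_sqr.
  by rewrite gtr0_norm// invfM.
rewrite /normal_fun; congr expR; rewrite -mulrBr !exprMn; field.
by rewrite cn0 s0.
Qed.

(** After substituting [c * x] for [x], each density gains a factor [c^-1]. The squared difference
    of the roots gains the same factor, which cancels the Jacobian [c]. *)
Lemma hellinger_normal_scale (R : realType) (c m m' s s' : R) :
  0 < c -> s != 0 -> s' != 0 ->
  hellinger (normal_pdf (c * m) (c * s)) (normal_pdf (c * m') (c * s')) =
  hellinger (normal_pdf m s) (normal_pdf m' s').
Proof.
move=> c0 s0 s'0; rewrite /hellinger /Rintegral.
(* It suffices to compare the extended-real integrals under [fine], which is where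
   [ge0_integral_scale] applies. *)
apply: (congr1 (fun z => Num.sqrt (2^-1 * fine z))).
have cn0 : c != 0 by rewrite gt_eqF.
have ct n t : t != 0 -> continuous (fun x : R => Num.sqrt (normal_pdf n t x)).
  move=> t0 x; apply: (@continuous_comp _ _ _ _ Num.sqrt).
    exact: continuous_normal_pdf.
  exact: sqrt_continuous.
have cD (f g : R -> R) : continuous f -> continuous g ->
    continuous (fun x : R => (f x - g x) ^+ 2).
  move=> cf cg x; apply: (@continuous_comp R R R (f \- g) (fun y => y ^+ 2)).
    by apply: continuousB; [exact: cf|exact: cg].
  exact: exprn_continuous.
rewrite (@ge0_integral_scale _ c) //; last 2 first.
- by apply: cD; apply: ct; rewrite mulf_neq0.
- by move=> x; exact: sqr_ge0.
apply: eq_integral => x _; congr (_%:E).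
rewrite !normal_pdf_scale// !sqrtrM ?invr_ge0 ?ltW// -mulrBr exprMn.
by rewrite sqr_sqrtr ?invr_ge0 ?ltW// mulrAC mulVf ?mul1r.
Qed.

Lemma proj_var_pre_cov_gt0 (R : realType) (rho : R) (v : 'cV[R]_2) :
  `|rho| < 1 -> v^T *m v = 1%:M -> 0 < proj_var v (pre_cov rho).
Proof.
move=> rho1 /matrixP/(_ ord0 ord0).
rewrite /proj_var !(mxE, big_ord_recl, big_ord0) /=.
set x := v _ _; set y := v _ _ => h.
rewrite ltr_norml in rho1; case/andP: rho1 => r1 r2.
(* Spectral form of the quadratic form: [1 + rho] and [1 - rho] are the eigenvalues, along the
   diagonal and the antidiagonal. *)
have -> : (x * 1 + (y * rho + 0)) * x + ((x * rho + (y * 1 + 0)) * y + 0) =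
          (1 + rho) / 2 * (x + y) ^+ 2 + (1 - rho) / 2 * (x - y) ^+ 2 by field.
have hpq : (x + y) ^+ 2 + (x - y) ^+ 2 = 2.
  by transitivity (2 * (x * x + (y * y + 0))); [ring | rewrite h mulr1].
(* Both weights are positive and the two squares sum to 2, so at least one term is positive. *)
have [p0|p0] := ltP 0 ((x + y) ^+ 2).
  by apply: ltr_wpDr; [apply: mulr_ge0; [lra | exact: sqr_ge0] | apply: mulr_gt0; lra].
by apply: ltr_wpDl; [apply: mulr_ge0; [lra | exact: sqr_ge0] | apply: mulr_gt0; lra].
Qed.

Lemma proj_varZ (R : realType) (n : nat) (v : 'cV[R]_n) (k : R) (S : 'M[R]_n) :
  proj_var v (k *: S) = k * proj_var v S.
Proof. by rewrite /proj_var -scalemxAr -scalemxAl mxE. Qed.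

Lemma post_cov_equal_change (R : realType) (a rho : R) :
  post_cov a a 1 rho = a ^+ 2 *: pre_cov rho.
Proof.
apply/matrixP => i j; rewrite !mxE.
by case: i j => [[|[|//]] ?] [[|[|//]] ?] /=; rewrite !(mulr1, expr2).
Qed.

Lemma sensitivity_equal_change (R : realType) (n : nat) (a : R)
    (S : 'M[R]_n) (v : 'cV[R]_n) : 0 < a -> 0 < proj_var v S ->
  sensitivity 0 0 S (a ^+ 2 *: S) v = hellinger (normal_pdf 0 1) (normal_pdf 0 a).
Proof.
move=> a0; rewrite /sensitivity /normal_density proj_varZ /proj_mean mulmx0 mxE.
move: (proj_var v S) => s2 s2_gt0.
(* The standard deviations become [s * 1] and [s * a] with [s = Num.sqrt s2], so [s] serves as the
   common scale [c]. *)
have -> : Num.sqrt (a ^+ 2 * s2) = Num.sqrt s2 * a.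
  by rewrite sqrtrM ?sqr_ge0// sqrtr_sqr gtr0_norm// mulrC.
have s_gt0 : 0 < Num.sqrt s2 by rewrite sqrtr_gt0.
have := hellinger_normal_scale R _ 0 0 _ _ s_gt0 (oner_neq0 R) (lt0r_neq0 a0).
rewrite mulr0 mulr1.
(* Abstracting both functions keeps conversion from unfolding the integrals. *)
by move: (@hellinger R) (@normal_pdf R) => d f.
Qed.

Theorem proposition2 (R : realType) (rho mu1 mu2 a11 a22 a12 a : R)
    (lam : 'I_2 -> R) (v : 'I_2 -> 'cV[R]_2)
    (hrho : -1 < rho < 1) (hrho0 : 0 < `|rho| < 1)
    (ha : 0 < a) (ha1 : a != 1)
    (hmu1 : mu1 = 0) (hmu2 : mu2 = 0)
    (ha12 : a12 = 1) (ha11 : a11 = a) (ha22 : a22 = a)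
    (heig : ordered_eigenpairs (pre_cov rho) lam v) :
  let H (j : 'I_2) : R :=
    sensitivity (pre_mean R) (post_mean mu1 mu2)
                (pre_cov rho) (post_cov a11 a22 a12 rho) (v j) in
  H (Ordinal (isT : (1 < 2)%N)) = H (Ordinal (isT : (0 < 2)%N)).
Proof.
have [_ _ _ v1] := heig; have /andP[_ rho1] := hrho0.
rewrite /= hmu1 hmu2 ha12 ha11 ha22 post_cov_equal_change.
have -> : post_mean 0 0 = 0 :> 'cV[R]_2.
  by apply/matrixP => -[[|[|//]] ?] j; rewrite !mxE.
(* Both sides become the same distance, which involves neither [rho] nor the direction; the unit
   norms [v1] give the positive projected variances. *)
by rewrite !sensitivity_equal_change// proj_var_pre_cov_gt0.
Qed.
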